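(* Let $B$ be a separable Banach space and let $\zeta,\gamma\in\mathcal{P}_1(B)$. Then the following are equivalent: (1) $\zeta\leq_{\mathrm{cx}}\gamma$ and $\zeta$ is finitely-supported. (2) $\zeta$ is a barycentric quantisation of $\gamma$ with respect to $(\pi,\Pi_1,\Pi_2)$, for some $\pi\in\mathcal{P}_1(B\times B)$ with second marginal $\gamma$ and some finite partitions $\Pi_1,\Pi_2\subseteq\mathcal{B}(B)$ of $B$. (3) $\zeta$ is a barycentric quantisation of $\gamma$ with respect to $(\pi,\Pi_1,\{B\})$, for some $\pi\in\mathcal{P}_1(B\times B)$ with second marginal $\gamma$ and some finite partition $\Pi_1\subseteq\mathcal{B}(B)$ of $B$.
   Context: $\mathcal{B}(B)$ is the Borel $\sigma$-algebra of $B$, and $\mathcal{P}_1(E)$ denotes the set of Borel probabilities on $E$ with finite first moment ($E=B$ or $E=B\times B$). $\zeta\leq_{\mathrm{cx}}\gamma$ means $\int f\,d\zeta\leq\int f\,d\gamma$ for every Lipschitz convex $f:B\to\mathbb{R}$. Barycentric quantisation: given $\gamma,\zeta\in\mathcal{P}_1(B)$ with $\zeta$ finitely-supported, a Borel probability $\pi$ on $B\times B$ whose second marginal is $\gamma$, and finite partitions $\Pi_1=(P_{1,i})_{i\in I}$, $\Pi_2=(P_{2,j})_{j\in J}\subseteq\mathcal{B}(B)$ of $B$, $\zeta$ is called the barycentric quantisation of $\gamma$ with respect to $(\pi,\Pi_1,\Pi_2)$ if $$\zeta=\sum_{i\in I,\,j\in J:\ \pi_{i,j}>0}\pi_{i,j}\,\delta_{y_{i,j}},\qquad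 \pi_{i,j}:=\pi(P_{1,i}\times P_{2,j}),\qquad y_{i,j}:=\frac{1}{\pi_{i,j}}\int_{P_{1,i}\times P_{2,j}}y\,\pi(dx,dy).$$ *)

(* Defs.v *)
From HB Require Import structures.
From mathcomp Require Import all_boot all_order all_algebra.
From mathcomp Require Import all_classical all_reals all_analysis.
Import Order.TTheory GRing.Theory Num.Theory.
Import numFieldNormedType.Exports.

Set Implicit Arguments.
Unset Strict Implicit.
Unset Printing Implicit Defensive.

Local Open Scope classical_set_scope.
Local Open Scope ring_scope.

Definition separable (T : topologicalType) : Prop :=
  exists2 S : set T, countable S & dense S.

(* [E] equipped with its Borel sigma-algebra.  On a product [B * B] this is the
   sigma-algebra generated by the open sets of the product topology, not the
   product sigma-algebra; the two agree when [B] is separable. *)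
Notation borel E := (g_sigma_algebraType (@open E%type)).

Section ConvexOrder.
Context {R : realType}.

(* On [B * B] the norm is the max norm. *)
Definition finite_first_moment (E : normedModType R)
    (mu : probability (borel E) R) : Prop :=
  (\int[mu]_x `|x : E|%:E < +oo)%E.

Definition finitely_supported (E : normedModType R)
    (mu : probability (borel E) R) : Prop :=
  exists2 S : set E, finite_set S & mu S = 1%E.

Definition convex_le (E : normedModType R) (zeta gamma : probability (borel E) R)
    : Prop :=
  forall f : E -> R^o, lipschitz f -> convex_function setT f ->
    (\int[zeta]_x (f x)%:E <= \int[gamma]_x (f x)%:E)%E.

End ConvexOrder.

Section BochnerIntegral.
Context d {T : measurableType d} {R : realType} {V : normedModType R}.
Variable mu : {finite_measure set T -> \bar R}.

Definition vector_simple (s : T -> V) : Prop :=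
  finite_set (range s) /\ forall v, measurable (s @^-1` [set v]).

Definition vector_simple_integral (D : set T) (s : T -> V) : V :=
  \sum_(v \in range s) fine (mu (D `&` s @^-1` [set v])) *: v.

(* Measurability of [f] cannot be dropped: the integral of a non-measurable
   nonnegative function is a lower integral, whose convergence to 0 would not
   determine [v]. *)
Definition is_bochner_integral (D : set T) (f : T -> V) (v : V) : Prop :=
  measurable_fun D (f : T -> borel V) /\
  exists s : nat -> T -> V,
    [/\ forall n, vector_simple (s n),
        (\int[mu]_(x in D) `|f x - s n x|%:E)%E @[n --> \oo] --> 0%E &
        vector_simple_integral D (s n) @[n --> \oo] --> v].

(* The value is 0 when [f] is not Bochner integrable over [D]. *)
Definition bochner_integral (D : set T) (f : T -> V) : V :=
  xget 0 [set v | is_bochner_integral D f v].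

End BochnerIntegral.

Section BarycentricQuantisation.
Context {R : realType} {B : completeNormedModType R}.

Definition second_marginal (pi : probability (borel (B * B)) R)
    (gamma : probability (borel B) R) : Prop :=
  forall A : set (borel B), measurable A ->
    pushforward pi (snd : borel (B * B) -> borel B) A = gamma A.

Definition borel_partition (I : finType) (P : I -> set (borel B)) : Prop :=
  partition setT P setT /\ forall i, measurable (P i).

Definition cell_mass (I J : finType) (pi : probability (borel (B * B)) R)
    (P1 : I -> set (borel B)) (P2 : J -> set (borel B)) (i : I) (j : J) : \bar R :=
  pi (P1 i `*` P2 j).

Definition cell_barycentre (I J : finType) (pi : probability (borel (B * B)) R)
    (P1 : I -> set (borel B)) (P2 : J -> set (borel B)) (i : I) (j : J) : B :=
  (fine (cell_mass pi P1 P2 i j))^-1 *: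
    bochner_integral pi (P1 i `*` P2 j) (snd : borel (B * B) -> B).

Definition barycentric_quantisation (I J : finType)
    (zeta gamma : probability (borel B) R) (pi : probability (borel (B * B)) R)
    (P1 : I -> set (borel B)) (P2 : J -> set (borel B)) : Prop :=
  [/\ finitely_supported zeta, second_marginal pi gamma,
      borel_partition P1, borel_partition P2 &
      forall A : set (borel B), measurable A ->
        zeta A = (\sum_(i : I) \sum_(j : J | (0 < cell_mass pi P1 P2 i j)%E)
          cell_mass pi P1 P2 i j * \d_(cell_barycentre pi P1 P2 i j : borel B) A)%E].

End BarycentricQuantisation.

(* Main.v *)
From HB Require Import structures.
Require Import Defs.
From mathcomp Require Import all_boot all_order all_algebra.
From mathcomp Require Import all_classical all_reals all_analysis.
From mathcomp Require Import finmap ring lra measurable_realfun.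
Import Order.TTheory GRing.Theory Num.Theory.
Import numFieldNormedType.Exports.
Set Implicit Arguments.
Unset Strict Implicit.
Unset Printing Implicit Defensive.
Local Open Scope classical_set_scope.
Local Open Scope ring_scope.

(** A barycentric quantisation is below gamma in convex order by Jensen's
    inequality: zeta puts the mass of each cell at the barycentre of the cell,
    and a Lipschitz convex function at a barycentre is at most its average over
    the cell.  The content is the converse, a form of Strassen's theorem.

    Both directions rest on one version of the Hahn-Banach theorem
    ([hahn_banach_cone]): a convex cone of constraints of the form l u <= r on
    a linear functional l can be satisfied as soon as none of them reads
    0 <= r with r < 0.  Applied to the difference quotients of a Lipschitz
    convex function it gives a [subgradient]; the subgradient of the norm is a
    norming functional.  Norming functionals reduce questions about Bochner
    integrals to real integrals, because a bounded functional of a Bochner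
    integral is the integral of the functional ([bochner_functional]).
    Jensen's inequality is then the subgradient inequality at the barycentre,
    integrated over the cell.

    For the converse let x_i be the support points of zeta and p_i their
    masses.  A coupling pi of zeta and gamma that is a martingale, in the sense
    that y has mean x_i given that the first coordinate is x_i, is a positive
    linear functional L on functions h(x_i, y) with
    - L h <= int u dgamma whenever h(x_i, y) <= u(y) for all i and y, and
    - L (1_{x_i} phi) = p_i phi(x_i) for affine phi.
    It suffices to ask the second condition as an inequality >= for Lipschitz
    convex phi.  The two together form a cone of constraints
    ([coupling_cone]).  It contains no contradiction: if phi_i <= u for all i,
    then f = max_i phi_i is Lipschitz convex and below u, so
    sum_i p_i phi_i(x_i) <= int f dzeta <= int f dgamma <= int u dgamma, where
    the middle step is the convex order.  So L exists.  Setting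
    pi(A) = L(1_A) defines a finitely additive content; it is dominated by
    sum_i gamma({y | (x_i, y) in A}), hence is sigma-additive.  The cell around x_i has mass p_i, and its
    barycentre is x_i because every bounded functional says so. *)

(** * A Hahn-Banach theorem for cones of constraints *)
Section HahnBanach.
Context {R : realType} {V : lmodType R}.
Implicit Types (C : set (V * R)) (u v w : V) (r s t : R).

(** A pair (u, r) stands for the constraint l u <= r on an unknown linear
    functional l.  The last clause makes the set of constrained vectors
    symmetric, so that l u is bounded on both sides as soon as it is bounded on
    one; without it the infimum of the admissible r could be -oo. *)
Definition constraint_cone C : Prop :=
  [/\ forall u r v s, C (u, r) -> C (v, s) -> C (u + v, r + s),
      forall t u r, 0 < t -> C (u, r) -> C (t *: u, t * r),
      forall r, C (0, r) -> 0 <= r &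
      forall u r, C (u, r) -> exists s, C (- u, s)].

(** The two families of bounds on the value at w are compatible, since adding
    a bound on w to a bound on -w yields a constraint on 0. *)
Lemma constraint_cone_slope C w : constraint_cone C ->
  exists a, (forall r, C (w, r) -> a <= r) /\
            (forall r, C (- w, r) -> - a <= r).
Proof.
move=> [CD _ C0 CN].
have Cge r s : C (w, r) -> C (- w, s) -> - s <= r.
  by move=> Cr Cs; have := C0 (r + s); rewrite -(subrr w) => /(_ (CD _ _ _ _ Cr Cs)); lra.
have [[r0 Cr0]|noC] := pselect (exists r, C (w, r)).
  have [s0 Cs0] := CN _ _ Cr0.
  pose E := [set r | C (w, r)].
  have lbE : lbound E (- s0) by move=> r Er; exact: Cge.
  exists (inf E); split=> [r Cr|s Cs].
    by apply: ge_inf => //; exists (- s0).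
  rewrite lerNl; apply: lb_le_inf; first by exists r0.
  by move=> r Er; exact: Cge.
exists 0; split=> [r Cr|s Cs]; first by case: noC; exists r.
by have [s'] := CN _ _ Cs; rewrite opprK => Cs'; case: noC; exists s'.
Qed.

(** Prescribing the value a at w amounts to adding the line through (w, a);
    this is the one-dimensional extension step. *)
Lemma constraint_cone_addline C w : constraint_cone C -> C (0, 0) ->
  exists2 D, constraint_cone D & C `<=` D /\ exists a, D (w, a) /\ D (- w, - a).
Proof.
move=> Ccone C00; have [a [aw awN]] := constraint_cone_slope w Ccone.
have [CD CZ C0 CN] := Ccone.
exists [set x | exists t v s, C (v, s) /\ x = (v + t *: w, s + t * a)].
  split=> [u r v s|t u r t0|r|u r].
  - move=> [t [u' [r' [Cu [-> ->]]]]] [t' [v' [s' [Cv [-> ->]]]]].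
    exists (t + t'), (u' + v'), (r' + s'); split; first exact: CD.
    by rewrite scalerDl mulrDl !addrA [u' + _ + _]addrAC [r' + _ + _]addrAC.
  - move=> [t' [u' [r' [Cu [-> ->]]]]].
    exists (t * t'), (t *: u'), (t * r'); split; first exact: CZ.
    by rewrite scalerDr scalerA mulrDr mulrA.
  - move=> [t [v [s [Cv [/esym/eqP vE rE]]]]]; rewrite {}rE; move: vE.
    rewrite addr_eq0 => /eqP vE; rewrite {}vE in Cv.
    have [t0|t0|t0] := ltgtP t 0.
    + have t'0 : 0 < - t by rewrite oppr_gt0.
      have /aw : C (w, (- t)^-1 * s).
        have := CZ (- t)^-1 _ _ _ Cv.
        rewrite -scaleNr scalerA mulVf ?gt_eqF//.
        by rewrite scale1r invr_gt0; exact.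
      by rewrite ler_pdivlMl// mulNr; lra.
    + have /awN : C (- w, t^-1 * s).
        have := CZ t^-1 _ _ _ Cv; rewrite scalerN scalerA mulVf ?gt_eqF//.
        by rewrite scale1r invr_gt0; exact.
      by rewrite ler_pdivlMl// mulrN; lra.
    + by move: Cv; rewrite t0 scale0r oppr0 mul0r addr0 => /C0.
  - move=> [t [v [s [Cv [-> _]]]]]; have [s' Cs'] := CN _ _ Cv.
    exists (s' + (- t) * a), (- t), (- v), s'; split => //.
    by rewrite opprD scaleNr.
split.
  by move=> [v s] Cv; exists 0, v, s; rewrite scale0r mul0r !addr0.
exists a; split.
  by exists 1, 0, 0; rewrite scale1r mul1r !add0r.
by exists (-1), 0, 0; rewrite scaleN1r mulN1r !add0r.
Qed.

(** A maximal cone of constraints contains a line over every vector, by the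
    extension step, and the slopes of these lines form the functional. *)
Theorem hahn_banach_cone C : constraint_cone C -> C (0, 0) ->
  exists l : {scalar V}, forall u r, C (u, r) -> l u <= r.
Proof.
move=> Ccone C00.
(* The union of the empty chain is empty, so containing C can only be required
   of nonempty cones. *)
pose P := [set A | constraint_cone A /\ (A !=set0 -> C `<=` A)].
have [|A [[Acone CA] Amax]] := @Zorn_bigcup _ P.
  move=> F FP Ftot; split; last first.
    by move=> [x [X FX Xx]] y Cy; exists X => //; apply: (FP _ FX).2 Cy; exists x.
  split.
  - move=> u r v s [X FX Xu] [Y FY Yv]; have [XY|YX] := Ftot _ _ FX FY.
      by exists Y => //; have [[h _ _ _] _] := FP _ FY; apply: h => //; exact: XY.
    by exists X => //; have [[h _ _ _] _] := FP _ FX; apply: h => //; exact: YX.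
  - move=> t u r t0 [X FX Xu]; exists X => //.
    by have [[_ h _ _] _] := FP _ FX; exact: h.
  - by move=> r [X FX Xr]; have [[_ _ h _] _] := FP _ FX; exact: h.
  - move=> u r [X FX Xu]; have [[_ _ _ h] _] := FP _ FX.
    by have [s Xs] := h _ _ Xu; exists s, X.
have A0 : A !=set0.
  apply: contrapT => A0; apply: (Amax C); last by split=> // _ x.
  split; first by move=> x Ax; case: A0; exists x.
  by move=> /(_ _ C00) Ax; case: A0; exists (0, 0).
have {}CA := CA A0; have A00 := CA _ C00.
have line w : exists a, A (w, a) /\ A (- w, - a).
  have [D Dcone [AD [a [Dw DNw]]]] := constraint_cone_addline w Acone A00.
  have DA : D `<=` A.
    apply: contrapT => nDA; apply: (Amax D); first by split.
    by split => // _; exact: subset_trans AD.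
  by exists a; split; exact: DA.
have [l /all_and2[lA lNA]] := choice line.
have [AD AZ Age0 _] := Acone.
have lZ t u : A (t *: u, t * l u).
  have [t0|t0|->] := ltgtP t 0; last by rewrite scale0r mul0r.
  - by rewrite -[t]opprK scaleNr -scalerN mulNr -mulrN; apply: AZ => //; rewrite oppr_gt0.
  - exact: AZ.
have lle u r : A (u, r) -> l u <= r.
  by move=> Au; have := Age0 _; rewrite -(subrr u) => /(_ _ (AD _ _ _ _ Au (lNA u))); lra.
have llin : linear_for *%R l.
  move=> t u v; apply/eqP; rewrite eq_le lle/=; last exact: AD.
  have /Age0 : A (0, - (t * l u) - l v + l (t *: u + v)).
    rewrite -(_ : - (t *: u) - v + (t *: u + v) = 0); last first.
      by rewrite -opprD addNr.
    apply: (AD _ _ _ _ _ (lA _)); apply: (AD _ _ _ _ _ (lNA v)).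
    by rewrite -scaleNr -mulNr.
  lra.
pose ll := GRing.isLinear.Build R V R _ l llin.
pose L : {scalar V} := HB.pack l ll.
by exists L => u r /CA /lle.
Qed.

End HahnBanach.

(** * Lipschitz convex functions, subgradients and norming functionals *)
Section LipschitzConvex.
Context {R : realType} {V : normedModType R}.
Implicit Types (f g : V -> R^o) (l : {scalar V}) (x y v w : V) (c k t : R).

Definition lipschitz_convex f : Prop := lipschitz f /\ convex_function setT f.

Lemma lipschitzP f : lipschitz f <->
  exists2 k : R, 0 <= k & forall x y, `|f x - f y| <= k * `|x - y|.
Proof.
split=> [/pinfty_ex_gt0[k k0 fk]|[k k0 fk]].
  by exists k; [exact: ltW|move=> x y; exact: (fk (x, y))].
apply: (@klipschitzW _ _ _ k); first exact: (@globally_properfilter _ _ (0, 0)).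
by move=> [x y] _ /=; exact: fk.
Qed.

Lemma convexP f : convex_function setT f <->
  forall t x y, 0 <= t <= 1 ->
    f (t *: x + (1 - t) *: y) <= t * f x + (1 - t) * f y.
Proof.
split=> [fc t x y t01|fc t x y _ _].
  have ti : Itv.spec (@Itv.num_sem R) (Itv.Real `[0%Z, 1%Z]) t.
    by rewrite /= /Itv.num_sem/= in_itv/= t01 (ger0_real (andP t01).1).
  by apply: (fc (Itv.mk ti)); exact: mem_set.
by apply: fc; rewrite ge0 le1.
Qed.

Lemma lipschitz_convexD f g : lipschitz_convex f -> lipschitz_convex g ->
  lipschitz_convex (fun x => f x + g x).
Proof.
move=> [/lipschitzP[k k0 fk] /convexP fc] [/lipschitzP[k' k'0 gk] /convexP gc].
split.
  apply/lipschitzP; exists (k + k'); first exact: addr_ge0.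
  move=> x y; rewrite opprD addrACA (le_trans (ler_normD _ _))// mulrDl.
  exact: lerD.
apply/convexP => t x y t01.
by have := fc t x y t01; have := gc t x y t01; lra.
Qed.

Lemma lipschitz_convexZ c f : 0 <= c -> lipschitz_convex f ->
  lipschitz_convex (fun x => c * f x).
Proof.
move=> c0 [/lipschitzP[k k0 fk] /convexP fc]; split.
  apply/lipschitzP; exists (c * k); first exact: mulr_ge0.
  by move=> x y; rewrite -mulrBr normrM (ger0_norm c0) -mulrA ler_wpM2l.
apply/convexP => t x y t01.
by rewrite mulrCA (mulrCA (1 - t)) -mulrDr ler_wpM2l// fc.
Qed.

Lemma lipschitz_convex_max f g : lipschitz_convex f -> lipschitz_convex g ->
  lipschitz_convex (fun x => Num.max (f x) (g x)).
Proof.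
move=> [/lipschitzP[k k0 fk] /convexP fc] [/lipschitzP[k' k'0 gk] /convexP gc].
split.
  apply/lipschitzP; exists (k + k'); first exact: addr_ge0.
  move=> x y; have := fk x y; have := gk x y.
  have : 0 <= k * `|x - y| by rewrite mulr_ge0.
  have : 0 <= k' * `|x - y| by rewrite mulr_ge0.
  rewrite mulrDl !ler_norml /Num.max.
  by case: ltP => ?; case: ltP => ? *; lra.
apply/convexP => t x y t01.
have t0 : 0 <= t by lra.
have t1 : 0 <= 1 - t by lra.
have ge_maxx z : f z <= Num.max (f z) (g z) by rewrite le_max lexx.
have ge_maxy z : g z <= Num.max (f z) (g z) by rewrite le_max lexx orbT.
rewrite ge_max; apply/andP; split.
  by apply: (le_trans (fc _ _ _ t01)); rewrite lerD// ler_wpM2l.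
by apply: (le_trans (gc _ _ _ t01)); rewrite lerD// ler_wpM2l.
Qed.

(** Both signs of c are of interest: for a bounded functional the barycentre
    inequality is used in both directions. *)
Lemma lipschitz_convex_scale_linear l c k : (forall v, `|l v| <= k * `|v|) ->
  lipschitz_convex (fun x => c * l x).
Proof.
move=> lk; split.
  apply/lipschitzP; exists (`|c| * `|k|) => [|x y]; first exact: mulr_ge0.
  rewrite -mulrBr -linearB normrM -mulrA ler_wpM2l//.
  by rewrite (le_trans (lk _))// ler_wpM2r// ler_norm.
by apply/convexP => t x y t01; rewrite linearD !linearZ/=; lra.
Qed.

Lemma lipschitz_convex_cst c : lipschitz_convex (fun=> c).
Proof.
split; first by apply/lipschitzP; exists 0 => // x y; rewrite subrr normr0 mul0r.
by apply/convexP => t x y _; lra.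
Qed.

Lemma lipschitz_convex_norm : lipschitz_convex (fun x => `|x|).
Proof.
split; first by apply/lipschitzP; exists 1 => // x y; rewrite mul1r ler_dist_dist.
apply/convexP => t x y /andP[t0 t1]; rewrite (le_trans (ler_normD _ _))// !normrZ.
by rewrite (ger0_norm t0) ger0_norm// subr_ge0.
Qed.

(** An iterated maximum needs a default value; taking it among the phi i keeps
    the maximum attained. *)
Lemma lipschitz_convex_bigmax (I : finType) (i0 : I) (phi : I -> V -> R^o) :
  (forall i, lipschitz_convex (phi i)) ->
  exists f, [/\ lipschitz_convex f, forall i x, phi i x <= f x &
                forall x, exists i, f x = phi i x].
Proof.
move=> phic; exists (fun x => \big[Num.max/phi i0 x]_i phi i x); split.
- elim: (index_enum I) => [|i s IH].
    by under eq_fun do rewrite big_nil.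
  by under eq_fun do rewrite big_cons; exact: lipschitz_convex_max.
- by move=> i x; exact: le_bigmax.
- move=> x; elim: (index_enum I) => [|i s [j IH]].
    by exists i0; rewrite big_nil.
  by rewrite big_cons IH /Num.max; case: ifP => _; [exists j|exists i].
Qed.

(** The constraints are l v <= (f (x + t v) - f x) / t for t > 0.  Convexity of f
    makes them closed under addition: the quotients at t and t' for u and v
    bound the quotient at t t' / (t + t') for u + v. *)
Lemma subgradient f x : lipschitz_convex f ->
  exists2 l : {scalar V}, (forall v, l v <= f (x + v) - f x) &
    exists k : R, forall v, `|l v| <= k * `|v|.
Proof.
move=> [/lipschitzP[k k0 fk] /convexP fc].
pose C := [set u : V * R | exists2 t : R, 0 < t & f (x + t *: u.1) - f x <= t * u.2].
have Cdom v : C (v, f (x + v) - f x) by exists 1; rewrite //= scale1r mul1r.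
have [||l lC] := @hahn_banach_cone R V C.
- split.
  + move=> u r v s [t/= t0 tr] [t'/= t'0 t's].
    pose a : R := t' / (t + t').
    have tt0 : 0 < t + t' by rewrite addr_gt0.
    have a01 : 0 <= a <= 1.
      by rewrite divr_ge0 ?(ltW t'0) ?(ltW tt0)//= ler_pdivrMr// mul1r lerDr ltW.
    have aE : (1 - a) * t' = a * t by rewrite /a; field; rewrite gt_eqF.
    exists (a * t); first by rewrite mulr_gt0// divr_gt0.
    have -> : x + (a * t) *: (u + v) =
        a *: (x + t *: u) + (1 - a) *: (x + t' *: v).
      rewrite !scalerDr !scalerA aE addrACA -scalerDl.
      by rewrite (_ : a + (1 - a) = 1) ?scale1r//; ring.
    have := fc a (x + t *: u) (x + t' *: v) a01.
    have /andP[a0 a1] := a01.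
    have : a * (f (x + t *: u) - f x) <= a * (t * r) by rewrite ler_wpM2l.
    have : (1 - a) * (f (x + t' *: v) - f x) <= (1 - a) * (t' * s).
      by rewrite ler_wpM2l// subr_ge0.
    rewrite [X in _ <= X -> _]mulrA aE /=.
    move: (f _) (f _) (f _) (f _) => F1 F2 F3 F4; lra.
  + move=> c u r c0 [t/= t0 tr]; exists (t / c); first by rewrite divr_gt0.
    by rewrite /= scalerA mulrA divfK ?gt_eqF.
  + move=> r [t /= t0]; rewrite scaler0 addr0 subrr.
    by rewrite pmulr_rge0.
  + by move=> u r _; exists (f (x - u) - f x); exact: Cdom.
- by have := Cdom 0; rewrite addr0 subrr.
exists l; first by move=> v; exact: lC.
exists k => v.
have lek w : l w <= k * `|w|.
  apply: (le_trans (lC _ _ (Cdom w))); apply: (le_trans (ler_norm _)).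
  by apply: (le_trans (fk _ _)); rewrite addrC addKr.
by rewrite ler_norml lek andbT lerNl -linearN (le_trans (lek _))// normrN.
Qed.

Lemma norming_functional v : exists2 l : {scalar V},
  (forall w, `|l w| <= `|w|) & l v = `|v|.
Proof.
have [l lv _] := subgradient v lipschitz_convex_norm.
have lle w : l w <= `|w|.
  by apply: (le_trans (lv w)); rewrite lerBlDl ler_normD.
exists l => [w|].
  by rewrite ler_norml lle andbT lerNl -linearN (le_trans (lle _))// normrN.
apply/eqP; rewrite eq_le lle/=.
by have := lv (- v); rewrite subrr normr0 linearN; lra.
Qed.

End LipschitzConvex.

(** * Bochner integrals through bounded functionals *)
Section Borel.
Context {R : realType}.

Lemma continuous_borel_measurable (E F : normedModType R) (g : E -> F) :
  continuous g -> measurable_fun setT (g : borel E -> borel F).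
Proof.
move=> /continuousP cg; apply: (@measurability _ _ (borel E) (borel F) _ _ open) => //.
by move=> _ [A oA <-]; rewrite setTI; apply: sub_sigma_algebra; exact: cg.
Qed.

Lemma continuous_borel_measurable_real (E : normedModType R) (g : E -> R) :
  continuous g -> measurable_fun setT (g : borel E -> R).
Proof.
move=> /continuousP cg; apply: (measurability _ (RGenOpens.measurableE R)).
move=> _ [_ [a [b ->] <-]]; rewrite setTI; apply: sub_sigma_algebra.
exact/cg/interval_open.
Qed.

Lemma measurable_norm d (T : measurableType d) (E : normedModType R) (D : set T)
    (g : T -> E) : measurable_fun D (g : T -> borel E) ->
  measurable_fun D (fun x => `|g x|).
Proof.
move=> mg; have mn : measurable_fun setT (fun y : borel E => `|y : E|).
  by apply: continuous_borel_measurable_real; exact: norm_continuous.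
exact: (measurableT_comp mn mg).
Qed.

End Borel.

Section LinearFunctional.
Context {R : realType} {V : normedModType R}.

Lemma bounded_functional_continuous (l : {scalar V}) k :
  (forall v, `|l v| <= k * `|v|) -> continuous (l : V -> R).
Proof.
move=> lk; apply: (@bounded_linear_continuous R V R^o l).
by apply/linear_boundedP; near=> r => x; apply: (le_trans (lk x)); rewrite ler_wpM2r.
Unshelve. all: by end_near. Qed.

End LinearFunctional.

Section Bochner.
Context d {T : measurableType d} {R : realType} {V : normedModType R}.
Variable mu : {finite_measure set T -> \bar R}.
Implicit Types (D : set T) (f s : T -> V) (v w : V) (l : {scalar V}) (k : R).

(** Glue over the finitely many level sets of s.  This is how the distance from
    a measurable map to a simple function is seen to be measurable. *)
Lemma measurable_fun_simple_param d' (T' : measurableType d') D s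
    (F : V -> T -> T') : vector_simple s -> (forall v, measurable_fun D (F v)) ->
  measurable_fun D (fun x => F (s x) x).
Proof.
move=> [sfin ms] mF mD A mA.
rewrite (_ : _ `&` _ = \bigcup_(v in range s)
    (s @^-1` [set v] `&` (D `&` F v @^-1` A))); last first.
  apply/seteqP; split=> [x [Dx Ax]|x [v _ [/= <- []]]//].
  by exists (s x).
by apply: fin_bigcup_measurable => // v _; apply: measurableI => //; exact: mF.
Qed.

Lemma integral_vector_simple D s (g : V -> R) : measurable D -> vector_simple s ->
  mu.-integrable D (EFin \o (g \o s)) /\
  \int[mu]_(x in D) g (s x) =
    \sum_(v \in range s) fine (mu (D `&` s @^-1` [set v])) * g v.
Proof.
move=> mD ss; have [sfin ms] := ss.
have gsE x : g (s x) = \sum_(v <- fset_set (range s)) g v * \1_(s @^-1` [set v]) x.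
  rewrite (big_fsetD1 (s x))/=; last by rewrite in_fset_set//; apply/mem_set; exists x.
  rewrite indicE mem_set// mulr1 big_seq big1 ?addr0// => v.
  rewrite !inE => /andP[/eqP vsx _]; rewrite indicE memNset ?mulr0//.
  by move=> /= /esym.
have int1 v : mu.-integrable D (fun x => (\1_(s @^-1` [set v]) x)%:E).
  exact: integrableS (integrable_indic mu (ms v)).
have intZ v : mu.-integrable D (fun x => (g v * \1_(s @^-1` [set v]) x)%:E).
  by under eq_fun do rewrite EFinM; exact: integrableZl.
have sumE : EFin \o (g \o s) = fun x =>
    (\sum_(v <- fset_set (range s)) (g v * \1_(s @^-1` [set v]) x)%:E)%E.
  by apply/funext => x; rewrite /= gsE sumEFin.
split; first by rewrite sumE; exact: integrable_sum.
rewrite /Rintegral.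
transitivity (fine (\int[mu]_(x in D) (EFin \o (g \o s)) x)%E) => //.
rewrite sumE integral_sum// fsbig_finite//= (_ : (\sum_(i <- _) _)%E =
  (\sum_(v <- fset_set (range s)) fine (mu (D `&` s @^-1` [set v])) * g v)%:E) //.
rewrite -sumEFin; apply: eq_bigr => v _.
under eq_integral do rewrite EFinM.
rewrite integralZl// integral_indic// EFinM muleC setIC fineK//.
by apply: fin_num_measure; exact: measurableI.
Qed.

Lemma functional_simple_integral l D s : measurable D -> vector_simple s ->
  l (vector_simple_integral mu D s) = \int[mu]_(x in D) l (s x).
Proof.
move=> mD ss; rewrite (integral_vector_simple l mD ss).2 /vector_simple_integral.
rewrite !fsbig_finite ?linear_sum//=; [|exact: ss.1..].
by apply: eq_bigr => v _; rewrite linearZ.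
Qed.

Lemma measurable_dist_simple D f s : measurable_fun D (f : T -> borel V) ->
  vector_simple s -> measurable_fun D (fun x => `|f x - s x|).
Proof.
move=> mf ss; apply: (@measurable_fun_simple_param _ R D s (fun v x => `|f x - v|)) => // v.
have mg : measurable_fun setT ((fun y : V => `|y - v|) : borel V -> R).
  apply: continuous_borel_measurable_real => y.
  by apply: cvg_norm; apply: cvgB => //; exact: cvg_cst.
exact: (measurableT_comp mg mf).
Qed.

(** This is the only estimate on simple approximations: it controls the simple
    integrals one functional at a time, which avoids comparing two simple
    functions on a common refinement. *)
Lemma functional_integral_dist D f s l k : measurable D ->
  measurable_fun D (f : T -> borel V) -> vector_simple s -> 0 <= k ->
  (forall v, `|l v| <= k * `|v|) ->
  (\int[mu]_(x in D) `|f x - s x|%:E < +oo)%E ->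
  mu.-integrable D (EFin \o (l \o f)) /\
  `|l (vector_simple_integral mu D s) - \int[mu]_(x in D) l (f x)| <=
    k * fine (\int[mu]_(x in D) `|f x - s x|%:E)%E.
Proof.
move=> mD mf ss k0 lk fsoo.
have md := measurable_dist_simple mf ss.
have mlf : measurable_fun D (l \o f).
  have ml := continuous_borel_measurable_real (bounded_functional_continuous lk).
  exact: (measurableT_comp ml mf).
have id : mu.-integrable D (EFin \o (fun x => `|f x - s x|)).
  apply/integrableP; split; first exact/measurable_EFinP.
  by under eq_integral do rewrite /= normr_id.
have ikd : mu.-integrable D (EFin \o (fun x => k * `|f x - s x|)).
  rewrite (_ : _ \o _ = (fun x => k%:E * `|f x - s x|%:E)%E) //.
  exact: integrableZl.
have [ils _] := integral_vector_simple l mD ss.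
have ilfs : mu.-integrable D (EFin \o (fun x => l (f x) - l (s x))).
  apply: le_integrable ikd => //.
    apply/measurable_EFinP; apply: measurable_funB => //.
    by apply/measurable_EFinP; exact: measurable_int ils.
  move=> x _; rewrite /= lee_fin [leRHS]ger0_norm ?mulr_ge0//.
  by rewrite -linearB.
have ilf : mu.-integrable D (EFin \o (l \o f)).
  rewrite (_ : _ \o _ = (EFin \o (fun x => l (f x) - l (s x))) \+ (EFin \o (l \o s))).
    exact: integrableD.
  by apply/funext => x /=; rewrite -EFinD subrK.
split => //; rewrite functional_simple_integral// distrC -RintegralB//.
apply: (le_trans (le_normr_Rintegral _ _)) => //.
rewrite -[X in k * X]/(\int[mu]_(x in D) `|f x - s x|) -RintegralZl//.
apply: le_Rintegral => //; first exact: integrable_norm.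
by move=> x _; rewrite -linearB.
Qed.

(** Passage to the limit in the preceding estimate along the approximating
    sequence. *)
Lemma bochner_functional D f v l k : measurable D ->
  is_bochner_integral mu D f v -> (forall w, `|l w| <= k * `|w|) ->
  mu.-integrable D (EFin \o (l \o f)) /\ l v = \int[mu]_(x in D) l (f x).
Proof.
move=> mD [mf [s [ss sf sv]]] lk.
have {}lk w : `|l w| <= `|k| * `|w|.
  by rewrite (le_trans (lk w))// ler_wpM2r// ler_norm.
have foo : \forall n \near \oo, (\int[mu]_(x in D) `|f x - s n x|%:E < +oo)%E.
  near=> n; rewrite -ge0_fin_numE; last exact: integral_ge0.
  near: n; exact: ((fine_cvgP _ _).1 sf).1.
have fd n := functional_integral_dist mD mf (ss n) (normr_ge0 k) lk.
split; first by have [n _ /(_ n (leqnn n)) /fd[]] := foo.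
have e0 : (fun n => `|k| * fine (\int[mu]_(x in D) `|f x - s n x|%:E)%E) @ \oo --> (0 : R).
  rewrite -[X in _ --> X](mulr0 `|k|); apply: cvgMr.
  exact: fine_cvg sf.
have lv : (fun n => l (vector_simple_integral mu D (s n))) @ \oo --> (l v : R).
  have lc := bounded_functional_continuous lk (x := v).
  exact: (cvg_comp _ _ sv lc).
apply: (cvg_unique (@Rhausdorff R) lv).
apply/cvgrPdist_le => e e_gt0; near=> n.
have /fd[_ ln] : (\int[mu]_(x in D) `|f x - s n x|%:E < +oo)%E by near: n.
rewrite distrC (le_trans ln)//.
rewrite -[leLHS]ger0_norm ?mulr_ge0 ?fine_ge0 ?integral_ge0//.
by rewrite -[X in `|X|]subr0 distrC; near: n; move/cvgrPdist_le : e0; exact.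
Unshelve. all: by end_near. Qed.

End Bochner.

Section BochnerComplete.
Context d {T : measurableType d} {R : realType} {V : completeNormedModType R}.
Variable mu : {finite_measure set T -> \bar R}.

(** The simple integrals form a Cauchy sequence: a functional norming the
    difference of two of them turns it into a difference of real integrals. *)
Lemma bochner_integral_exists D (f : T -> V) (s : nat -> T -> V) :
  measurable D -> measurable_fun D (f : T -> borel V) ->
  (forall n, vector_simple (s n)) ->
  (\int[mu]_(x in D) `|f x - s n x|%:E)%E @[n --> \oo] --> 0%E ->
  exists v, is_bochner_integral mu D f v.
Proof.
move=> mD mf ss sf.
pose e n := fine (\int[mu]_(x in D) `|f x - s n x|%:E)%E.
have e0 : e @ \oo --> (0 : R) by exact: fine_cvg sf.
have foo : \forall n \near \oo, (\int[mu]_(x in D) `|f x - s n x|%:E < +oo)%E.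
  near=> n; rewrite -ge0_fin_numE; last exact: integral_ge0.
  near: n; exact: ((fine_cvgP _ _).1 sf).1.
pose v n := vector_simple_integral mu D (s n).
have vD n m : (\int[mu]_(x in D) `|f x - s n x|%:E < +oo)%E ->
    (\int[mu]_(x in D) `|f x - s m x|%:E < +oo)%E -> `|v n - v m| <= e n + e m.
  move=> noo moo; have [l l1 lv] := norming_functional (v n - v m).
  have lk u : `|l u| <= 1 * `|u| by rewrite mul1r.
  have [_ ln] := functional_integral_dist mD mf (ss n) ler01 lk noo.
  have [_ lm] := functional_integral_dist mD mf (ss m) ler01 lk moo.
  rewrite -lv linearB/= (le_trans (ler_norm _))//.
  rewrite (le_trans (ler_distD (\int[mu]_(x in D) l (f x)) _ _))//.
  by rewrite mul1r in ln; rewrite mul1r in lm; rewrite lerD// distrC.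
have : cvg (v @ \oo).
  apply: cauchy_cvg; apply: cauchy_exP => eps eps0.
  have eps4 : 0 < eps / 4 by rewrite divr_gt0.
  have small : \forall n \near \oo, (\int[mu]_(x in D) `|f x - s n x|%:E < +oo)%E /\ e n <= eps / 4.
    near=> n; split; first by near: n.
    rewrite (le_trans (ler_norm _))// -[X in `|X|]subr0 distrC.
    by near: n; move/cvgrPdist_le : e0; exact.
  have [N _ Nsmall] := small.
  exists (v N); suff : \forall n \near \oo, ball (v N) eps (v n) by [].
  near=> n; rewrite -ball_normE/=.
  have [Noo Ne] := Nsmall N (leqnn N).
  have [noo ne] : (\int[mu]_(x in D) `|f x - s n x|%:E < +oo)%E /\ e n <= eps / 4.
    by near: n.
  by rewrite (le_lt_trans (vD _ _ Noo noo))//; lra.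
move=> /cvg_ex[w vw]; exists w; split => //; exists s; split => //.
Unshelve. all: by end_near. Qed.

End BochnerComplete.

(** * Existence of Bochner integrals in a separable space *)
Section NearestPoint.
Context {R : realType} {V : normedModType R}.
Implicit Types (a : nat -> V) (y v : V).

(** A nearest point to y among 0 and the first n terms of a.  Starting from 0
    keeps the distance to y below the norm of y, which is the dominating
    function needed for the convergence in mean. *)
Fixpoint nearest_point a n y : V :=
  if n is m.+1 then
    if `|y - a m| < `|y - nearest_point a m y| then a m else nearest_point a m y
  else 0.

Lemma nearest_point_dist a n y : `|y - nearest_point a n y| <= `|y|.
Proof.
elim: n => [|n IH] /=; first by rewrite subr0.
by case: ifPn => // /ltW /le_trans; exact.
Qed.

Lemma nearest_point_le a n k y : (k < n)%N ->
  `|y - nearest_point a n y| <= `|y - a k|.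
Proof.
elim: n => // n IH; rewrite ltnS leq_eqVlt => /predU1P[->|/IH kn] /=.
  by case: ifPn => //; rewrite -leNgt.
by case: ifPn => // /ltW /le_trans; exact.
Qed.

Lemma nearest_point_cvg a y : dense (range a) ->
  `|y - nearest_point a n y| @[n --> \oo] --> 0.
Proof.
move=> da; apply/cvgr0Pnorm_lt => e e0.
have [z [+ [k _ kz]]] :=
  da (ball y e) (ex_intro _ y (ballxx y e0)) (ball_open y e).
rewrite -{z}kz => ye; near=> n; rewrite normr_id (le_lt_trans (nearest_point_le _ _ (k := k) _))//.
  by near: n; exact: nbhs_infty_gt.
by move: ye; rewrite -ball_normE.
Unshelve. all: by end_near. Qed.

Lemma nearest_point_simple a n : vector_simple (nearest_point a n : borel V -> V).
Proof.
elim: n => [|n ss] /=.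
  split; first by apply: (@sub_finite_set _ _ [set 0]) => // _ [y _ <-].
  by move=> v; rewrite preimage_cst; case: ifP.
have [sfin ms] := ss.
split.
  apply: (@sub_finite_set _ _ ([set a n] `|` range (nearest_point a n))).
    move=> _ [y _ <-]; case: ifPn => _; first by left.
    by right; exists y.
  by rewrite finite_setU; split => //; exact: finite_set1.
move=> v; pose A := [set y : borel V | `|y - a n| < `|y - nearest_point a n y|].
have mA : measurable A.
  have m1 := measurable_dist_simple (@measurable_id _ (borel V) setT) ss.
  have m0 : measurable_fun setT (fun y : borel V => `|(y : V) - a n|).
    apply: continuous_borel_measurable_real => y.
    by apply: cvg_norm; apply: cvgB => //; exact: cvg_cst.
  have := measurable_realfun.measurable_fun_ltr m0 m1 measurableT
    (Y := [set true]) I.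
  by rewrite setTI; exact.
rewrite (_ : _ @^-1` _ = (A `&` [set y | a n = v]) `|`
    (~` A `&` nearest_point a n @^-1` [set v])).
  apply: measurableU; last by apply: measurableI => //; exact: measurableC.
  apply: measurableI => //; have [->|nv] := pselect (a n = v).
    by rewrite (_ : [set _ | _] = setT)//; apply/seteqP; split.
  by rewrite (_ : [set _ | _] = set0)//; apply/seteqP; split.
apply/seteqP; split=> y /=; rewrite /A /=.
  by case: ifPn => yA yv; [left|right]; split => //; exact/negP.
case=> -[yA yv]; first by rewrite yA.
by rewrite (negbTE (introN idP yA)).
Qed.

End NearestPoint.

Section BochnerExists.
Context d {T : measurableType d} {R : realType} {V : completeNormedModType R}.

Lemma separable_dense_seq : separable V -> exists a : nat -> V, dense (range a).
Proof.
move=> [S cS dS].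
have /pfcard_geP[S0|/surjfunPex[a Sa]] := cS.
  have [|//|x []] := dS setT; [by exists 0|exact: openT|by rewrite S0].
by exists a; rewrite -Sa.
Qed.

Lemma vector_simple_comp (f : T -> V) (s : V -> V) :
  measurable_fun setT (f : T -> borel V) -> vector_simple (s : borel V -> V) ->
  vector_simple (s \o f).
Proof.
move=> mf [sfin ms]; split.
  by apply: sub_finite_set sfin => _ [x _ <-]; exists (f x).
by move=> v; have := mf measurableT _ (ms v); rewrite setTI.
Qed.

(** Composing f with the nearest-point maps gives simple functions that
    converge pointwise to f, at distance at most the norm of f. *)
Lemma bochner_integral_separable (mu : {finite_measure set T -> \bar R}) D (f : T -> V) :
  separable V -> measurable D -> measurable_fun setT (f : T -> borel V) ->
  (\int[mu]_(x in D) `|f x|%:E < +oo)%E ->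
  exists v, is_bochner_integral mu D f v.
Proof.
move=> sepV mD mf foo; have [a da] := separable_dense_seq sepV.
have ss n := vector_simple_comp mf (nearest_point_simple a n).
have mfD : measurable_fun D (f : T -> borel V) by exact: measurable_funTS.
have mnorm : measurable_fun D (fun x => `|f x|).
  exact: measurable_norm.
apply: (bochner_integral_exists mD mfD ss).
have [|||||_ _] := @dominated_convergence _ T R mu D mD
  (fun n x => `|f x - (nearest_point a n \o f) x|%:E) (cst 0%E) (fun x => `|f x|%:E).
- by move=> n; apply/measurable_EFinP; exact: measurable_dist_simple.
- exact: measurable_cst.
- apply: aeW => x _; apply: cvg_EFin; first by apply: nearW.
  exact: nearest_point_cvg.
- apply/integrableP; split; first exact/measurable_EFinP.
  by under eq_integral do rewrite /= normr_id.
- by apply: aeW => x n _; rewrite /= lee_fin normr_id nearest_point_dist.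
by rewrite integral0.
Qed.

End BochnerExists.

(** * Marginals, sums of Dirac masses and integrable functions *)
Section Transport.
Context d d' (X : measurableType d) (Y : measurableType d') (R : realType).

Lemma integral_marginal (phi : X -> Y) (mu : {measure set X -> \bar R})
    (nu : {measure set Y -> \bar R}) (f : Y -> R) :
  measurable_fun setT phi ->
  (forall A, measurable A -> mu (phi @^-1` A) = nu A) ->
  nu.-integrable setT (EFin \o f) ->
  mu.-integrable setT (EFin \o (f \o phi)) /\
  \int[nu]_y f y = \int[mu]_x f (phi x).
Proof.
move=> mphi munu fi.
pose Phi : {mfun X >-> Y} := HB.pack phi (isMeasurableFun.Build _ _ _ _ phi mphi).
have mf := measurable_int _ fi.
have eqI (g : Y -> \bar R) :
    (\int[nu]_y g y = \int[pushforward mu phi]_y g y)%E.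
  rewrite -[pushforward mu phi]/(pushforward mu Phi).
  by apply: eq_measure_integral => A mA _; rewrite /= /pushforward munu.
have fphi : mu.-integrable setT (EFin \o (f \o phi)).
  apply/integrableP; split; first exact: (measurableT_comp mf mphi).
  case/integrableP : (fi) => _; apply: le_lt_trans.
  rewrite eqI ge0_integral_pushforward//.
  exact: measurableT_comp.
split => //.
by rewrite /Rintegral eqI integral_pushforward.
Qed.

End Transport.

Section DiracSum.
Context d (T : measurableType d) (R : realType) (K : finType) (P : pred K).
Variables (w : K -> R) (y : K -> T).
Hypothesis w0 : forall k, 0 <= w k.

(** The points y k may coincide, as several cells may share a barycentre, so
    the sum cannot be computed from the masses of singletons. *)
Lemma ge0_integral_dirac_sum (mu : {measure set T -> \bar R}) (f : T -> \bar R) :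
  (forall A, measurable A -> (mu A = \sum_(k | P k) (w k)%:E * \d_(y k) A)%E) ->
  measurable_fun setT f -> (forall x, 0 <= f x)%E ->
  (\int[mu]_x f x = \sum_(k | P k) (w k)%:E * f (y k))%E.
Proof.
move=> muE mf f0.
suff [m mE mI] : exists2 m : {measure set T -> \bar R},
    forall A, (m A = \sum_(k | P k) (w k)%:E * \d_(y k) A)%E &
    (\int[m]_x f x = \sum_(k | P k) (w k)%:E * f (y k))%E.
  by rewrite -mI; apply: eq_measure_integral => A mA _; rewrite muE// mE.
elim: (index_enum K) => [|k s [m mE mI]].
  exists mzero; first by move=> A; rewrite big_nil.
  by rewrite big_nil integral_measure_zero.
have [Pk|nPk] := boolP (P k); last first.
  by exists m => [A|]; rewrite big_cons (negbTE nPk).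
exists (measure_add (mscale (NngNum (w0 k)) (\d_(y k))) m) => [A|].
  by rewrite big_cons Pk -mE; exact: measure_addE.
rewrite big_cons Pk ge0_integral_measure_add// mI ge0_integral_mscale//.
by rewrite integral_dirac// diracT mul1e.
Qed.

Lemma integral_dirac_sum (mu : {measure set T -> \bar R}) (f : T -> R) :
  (forall A, measurable A -> (mu A = \sum_(k | P k) (w k)%:E * \d_(y k) A)%E) ->
  measurable_fun setT f -> \int[mu]_x f x = \sum_(k | P k) w k * f (y k).
Proof.
move=> muE mf; have mEf : measurable_fun setT (EFin \o f) by exact/measurable_EFinP.
transitivity (fine (\int[mu]_x (EFin \o f) x)%E) => //; rewrite integralE.
rewrite (ge0_integral_dirac_sum muE (measurable_funepos mEf))//.
rewrite (ge0_integral_dirac_sum muE (measurable_funeneg mEf))//.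
have sumE g h : (forall k, g (y k) = (h k)%:E) ->
    (\sum_(k | P k) (w k)%:E * g (y k))%E = (\sum_(k | P k) w k * h k)%:E.
  by move=> gh; rewrite -sumEFin; apply: eq_bigr => k _; rewrite gh.
rewrite (sumE _ (fun k => Num.max (f (y k)) 0)); last first.
  by move=> k; rewrite funeposE EFin_max.
rewrite (sumE _ (fun k => Num.max (- f (y k)) 0)); last first.
  by move=> k; rewrite funenegE EFin_max.
rewrite -EFinB /= -sumrB; apply: eq_bigr => k _; rewrite -mulrBr; congr (_ * _).
by rewrite /Num.max; case: ltP => ?; case: ltP => ?; lra.
Qed.

End DiracSum.

Section LipschitzIntegrable.
Context {R : realType} {V : normedModType R}.
Implicit Types f : V -> R^o.

Lemma lipschitz_borel_measurable f : lipschitz f ->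
  measurable_fun setT (f : borel V -> R).
Proof.
move=> /lipschitzP[k k0 fk]; apply: continuous_borel_measurable_real => x.
apply/cvgrPdist_le => e e0; have [k_eq0|k_neq0] := eqVneq k 0.
  by apply: nearW => y; rewrite (le_trans (fk x y))// k_eq0 mul0r ltW.
have k_gt0 : 0 < k by rewrite lt_neqAle eq_sym k_neq0.
near=> y; rewrite (le_trans (fk x y))// mulrC -ler_pdivlMr//.
by near: y; apply: cvgr_dist_le => //; rewrite divr_gt0.
Unshelve. all: by end_near. Qed.

Lemma lipschitz_integrable f d (T : measurableType d)
    (mu : {finite_measure set T -> \bar R}) (g : T -> V) :
  lipschitz f -> measurable_fun setT (g : T -> borel V) ->
  (\int[mu]_x `|g x|%:E < +oo)%E -> mu.-integrable setT (EFin \o (f \o g)).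
Proof.
move=> lf mg goo; have mf := lipschitz_borel_measurable lf.
have /lipschitzP[k k0 fk] := lf.
have mn : measurable_fun setT (fun x => `|g x|).
  exact: measurable_norm.
have gi : mu.-integrable setT (fun x => `|g x|%:E).
  apply/integrableP; split; first exact/measurable_EFinP.
  by under eq_integral do rewrite /= normr_id.
have ci : mu.-integrable setT (fun x => (`|f 0| + k * `|g x|)%:E).
  rewrite (_ : (fun _ => _) = (EFin \o cst `|f 0|) \+ (fun x => k%:E * `|g x|%:E)%E) //.
  apply: integrableD => //; first exact: finite_measure_integrable_cst.
  exact: integrableZl.
apply: le_integrable ci => //; first exact/measurable_EFinP/(measurableT_comp mf mg).
move=> x _; rewrite /= lee_fin [leRHS]ger0_norm; last by rewrite addr_ge0 ?mulr_ge0.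
rewrite -[X in `|X|](subrK (f 0)) addrC (le_trans (ler_normD _ _))// lerD//.
by rewrite (le_trans (fk _ _))// subr0.
Qed.

(** Lipschitz functions are integrable against measures with finite first
    moment, so the extended-real inequality is one between real integrals. *)
Lemma convex_leP (zeta gamma : probability (borel V) R) :
  finite_first_moment zeta -> finite_first_moment gamma ->
  convex_le zeta gamma <-> forall f, lipschitz_convex f ->
    \int[zeta]_x f x <= \int[gamma]_x f x.
Proof.
move=> zeta1 gamma1.
have fin f (mu : probability (borel V) R) : lipschitz f -> finite_first_moment mu ->
    ((\int[mu]_x f x)%:E = \int[mu]_x (f x)%:E)%E.
  move=> lf mu1; rewrite fineK//; apply: integrable_fin_num => //.
  exact: (@lipschitz_integrable f _ (borel V) mu idfun lf (@measurable_id _ _ _) mu1).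
split=> [h f [lf cf]|h f lf cf]; first by rewrite -lee_fin !fin//; exact: h.
by rewrite -!fin// lee_fin; exact: h.
Qed.

End LipschitzIntegrable.

(** * A quantisation is smaller in convex order *)
Section Jensen.
Context d (T : measurableType d) {R : realType} {V : normedModType R}.
Variable mu : {finite_measure set T -> \bar R}.

(** Integrate the affine minorant of f that touches it at the barycentre. *)
Lemma jensen_bochner D (g : T -> V) v (f : V -> R^o) : measurable D ->
  (0 < mu D)%E -> is_bochner_integral mu D g v -> lipschitz_convex f ->
  mu.-integrable D (EFin \o (f \o g)) ->
  fine (mu D) * f ((fine (mu D))^-1 *: v) <= \int[mu]_(x in D) f (g x).
Proof.
move=> mD D0 gv fc fgi; pose m := fine (mu D); pose x0 := m^-1 *: v.
have m0 : 0 < m.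
  by rewrite fine_gt0// D0/= -ge0_fin_numE// fin_num_measure.
have [l lf [k lk]] := subgradient x0 fc.
have [lgi lvE] := bochner_functional mD gv lk.
pose c := f x0 - l x0.
have ci : mu.-integrable D (EFin \o cst c) by exact: finite_measure_integrable_cst.
have -> : m * f x0 = \int[mu]_(x in D) (l (g x) + c).
  rewrite RintegralD// -lvE Rintegral_cst// -/m /c /x0 linearZ/=; field.
  by rewrite gt_eqF.
apply: le_Rintegral => //.
  rewrite (_ : EFin \o _ = (EFin \o (l \o g)) \+ (EFin \o cst c)) //.
  exact: integrableD.
move=> x _; have := lf (g x - x0); rewrite (addrC x0) subrK linearB/= /c; lra.
Qed.

End Jensen.

Section Product.
Context {R : realType} {E : completeNormedModType R}.

Lemma measurable_fst_borel : measurable_fun setT (fst : borel (E * E) -> borel E).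
Proof. by apply: continuous_borel_measurable => -[x y]; exact: cvg_fst. Qed.

Lemma measurable_snd_borel : measurable_fun setT (snd : borel (E * E) -> borel E).
Proof. by apply: continuous_borel_measurable => -[x y]; exact: cvg_snd. Qed.

Lemma measurable_rectangle_borel (A C : set (borel E)) :
  measurable A -> measurable C -> measurable (A `*` C : set (borel (E * E))).
Proof.
move=> mA mC; have := measurable_fst_borel measurableT mA.
have := measurable_snd_borel measurableT mC; rewrite !setTI => m2 m1.
exact: measurableI.
Qed.

Lemma bochner_integral_snd_exists (pi : probability (borel (E * E)) R)
    (D : set (borel (E * E))) : separable E -> measurable D ->
  finite_first_moment pi ->
  is_bochner_integral pi D (snd : borel (E * E) -> E)
    (bochner_integral pi D (snd : borel (E * E) -> E)).
Proof.
move=> sepE mD pi1.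
have msnd : measurable_fun setT (fun x : borel (E * E) => `|x.2 : E|%:E).
  by apply/measurable_EFinP/measurable_norm; exact: measurable_snd_borel.
have [|v vE] := bochner_integral_separable (mu := pi) sepE mD measurable_snd_borel.
  apply: le_lt_trans pi1.
  apply: (@le_trans _ _ (\int[pi]_x `|x.2 : E|%:E)%E).
    exact: ge0_subset_integral.
  apply: ge0_le_integral => //.
    by apply/measurable_EFinP/measurable_norm; exact: measurable_id.
  by move=> x _; rewrite lee_fin prod_normE le_max lexx orbT.
by apply: (@xgetPex _ 0); exists v.
Qed.

End Product.

Section Partition.
Context d (T : measurableType d) {R : realType}.
Variable mu : {finite_measure set T -> \bar R}.

Lemma Rintegral_partition (K : finType) (C : K -> set T) (f : T -> R) :
  (forall k, measurable (C k)) -> trivIset setT C -> cover setT C = setT ->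
  mu.-integrable setT (EFin \o f) ->
  \int[mu]_x f x = \sum_k \int[mu]_(x in C k) f x.
Proof.
move=> mC tC cC fi.
have CE : \big[setU/set0]_(k <- index_enum K) C k = setT.
  rewrite -bigcup_seq; apply/seteqP; split=> // x.
  by rewrite -cC => -[k _ Ckx]; exists k => //=; rewrite mem_index_enum.
rewrite /Rintegral -CE integral_bigsetU_EFin ?CE ?index_enum_uniq//; last 2 first.
- exact: sub_trivIset tC.
- exact: measurable_int fi.
rewrite -sum_fine// => k _; apply: integrable_fin_num => //.
exact: integrableS fi.
Qed.

End Partition.

Section QuantisationConvexLe.
Context {R : realType} {B : completeNormedModType R}.

(** Jensen's inequality on each cell of positive mass; the cells of mass zero
    contribute nothing to either side. *)
Theorem barycentric_quantisation_convex_le (I J : finType)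
    (zeta gamma : probability (borel B) R) (pi : probability (borel (B * B)) R)
    (P1 : I -> set (borel B)) (P2 : J -> set (borel B)) :
  separable B -> finite_first_moment zeta -> finite_first_moment gamma ->
  finite_first_moment pi -> barycentric_quantisation zeta gamma pi P1 P2 ->
  convex_le zeta gamma.
Proof.
move=> sepB zeta1 gamma1 pi1 [_ marg [[cov1 triv1 _] mP1] [[cov2 triv2 _] mP2] zetaE].
apply/convex_leP => // f fc; have [lf _] := fc.
pose C (k : I * J) : set (borel (B * B)) := P1 k.1 `*` P2 k.2.
pose b (k : I * J) : borel B := cell_barycentre pi P1 P2 k.1 k.2.
have mC k : measurable (C k) by exact: measurable_rectangle_borel.
have fsnd : measurable_fun setT (f : borel B -> R) by exact: lipschitz_borel_measurable.
have fgi : gamma.-integrable setT (EFin \o f).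
  exact: (@lipschitz_integrable _ _ f _ (borel B) gamma idfun lf (@measurable_id _ _ _) gamma1).
have [fsi ->] := integral_marginal measurable_snd_borel marg fgi.
rewrite (@integral_dirac_sum _ _ R _ (fun k => 0 < pi (C k))%E
    (fun k => fine (pi (C k))) b _ zeta f) //; last 2 first.
- by move=> k; rewrite fine_ge0.
- move=> A mA; apply: (etrans (zetaE A mA)); rewrite pair_big_dep/=.
  by apply: eq_bigr => k _; rewrite fineK// fin_num_measure.
rewrite (@Rintegral_partition _ _ R pi _ C)//; last 2 first.
- move=> [i j] [i' j'] _ _ [[x y] [/= [/= xi yj] [/= xi' yj']]].
  by congr pair; [apply: triv1 => //; exists x|apply: triv2 => //; exists y].
- apply/seteqP; split => // -[x y] _.
  have : setT x by []; rewrite -cov1 => -[i _ xi].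
  have : setT y by []; rewrite -cov2 => -[j _ yj].
  by exists (i, j).
rewrite big_mkcond; apply: ler_sum => k _; case: ifPn => [C0|].
  apply: jensen_bochner => //; first exact: bochner_integral_snd_exists.
  exact: integrableS fsi.
rewrite -leNgt => C0; rewrite /Rintegral null_set_integral//.
  by apply: measurable_funTS; exact: measurable_int fsi.
by apply/eqP; rewrite eq_le C0 measure_ge0.
Qed.

End QuantisationConvexLe.

(** * The constraints on a martingale coupling with finitely supported first marginal *)
Section CouplingCone.
Context {R : realType} {B : normedModType R}.
Variables (gamma : probability (borel B) R) (I : finType) (x : I -> B) (p : I -> R).
Hypothesis gamma1 : finite_first_moment gamma.
Hypothesis p_ge0 : forall i, 0 <= p i.
Hypothesis p_le : forall f : B -> R^o, lipschitz_convex f ->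
  \sum_i p i * f (x i) <= \int[gamma]_y f y.
Implicit Types (h : B * B -> R^o) (u H : B -> R) (phi : I -> B -> R^o).

Local Notation gamma_integrable u := (gamma.-integrable setT (EFin \o u)).

(** Only the values of h on the lines {x i} x B matter: the coupling is to be
    carried by them.  A bound by an integrable function of y applies to h and
    -h alike, which makes the constrained functions a symmetric set. *)
Definition dominated h : Prop :=
  exists2 H, gamma_integrable H & forall i y, `|h (x i, y)| <= H y.

(** With L the integral against the coupling, each constraint
    L h <= int u dgamma - sum_i p_i phi_i(x_i) combines the second-marginal
    bound L (h + phi) <= int u dgamma, where phi(x_i, y) = phi_i(y), with the
    barycentre bounds p_i phi_i(x_i) <= L (1_{x_i} phi_i). *)
Definition coupling_cone : set ((B * B -> R^o) * R) :=
  [set hr | dominated hr.1 /\ exists u phi,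
    [/\ gamma_integrable u, forall i, lipschitz_convex (phi i),
        forall i y, hr.1 (x i, y) + phi i y <= u y &
        \int[gamma]_y u y - \sum_i p i * phi i (x i) <= hr.2]].

Lemma dominatedD h h' : dominated h -> dominated h' -> dominated (h + h').
Proof.
move=> [H Hi hH] [H' Hi' hH']; exists (fun y => H y + H' y).
  rewrite (_ : _ \o _ = (EFin \o H) \+ (EFin \o H')) //; exact: integrableD.
by move=> i y; rewrite (le_trans (ler_normD _ _))// lerD.
Qed.

Lemma dominatedZ t h : dominated h -> dominated (t *: h).
Proof.
move=> [H Hi hH]; exists (fun y => `|t| * H y).
  rewrite (_ : _ \o _ = (fun y => `|t|%:E * (H y)%:E)%E) //; exact: integrableZl.
by move=> i y; rewrite normrM ler_wpM2l.
Qed.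

Lemma dominatedN h : dominated h -> dominated (- h).
Proof. by rewrite -scaleN1r; exact: dominatedZ. Qed.

Lemma lipschitz_convex_gamma_integrable (f : B -> R^o) : lipschitz_convex f ->
  gamma_integrable f.
Proof.
move=> [lf _]; exact: (@lipschitz_integrable _ _ f _ (borel B) gamma idfun lf
  (@measurable_id _ _ _) gamma1).
Qed.

(** This is where the convex order enters: the maximum f of the phi_i is
    Lipschitz convex and lies below u when h = 0. *)
Lemma coupling_cone_constraint (i0 : I) : constraint_cone coupling_cone.
Proof.
split=> [h r h' r'|t h r t0|r|h r].
- move=> [/= hd [u [phi [ui phic hu ur]]]] [/= hd' [u' [phi' [ui' phic' hu' ur']]]].
  split; first exact: dominatedD.
  exists (fun y => u y + u' y), (fun i y => phi i y + phi' i y); split.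
  + rewrite (_ : _ \o _ = (EFin \o u) \+ (EFin \o u')) //; exact: integrableD.
  + by move=> i; exact: lipschitz_convexD.
  + by move=> i y; have := hu i y; have := hu' i y; rewrite /= fctE; lra.
  + rewrite /= RintegralD//; under eq_bigr do rewrite mulrDr.
    by rewrite big_split/=; lra.
- move=> [/= hd [u [phi [ui phic hu ur]]]]; split; first exact: dominatedZ.
  exists (fun y => t * u y), (fun i y => t * phi i y); split.
  + rewrite (_ : _ \o _ = (fun y => t%:E * (u y)%:E)%E) //; exact: integrableZl.
  + by move=> i; apply: lipschitz_convexZ => //; exact: ltW.
  + move=> i y; rewrite /= fctE.
    by rewrite -[t *: _]/(t * _) -mulrDr ler_wpM2l// ltW.
  + rewrite /= RintegralZl//; under eq_bigr do rewrite mulrCA.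
    by rewrite -mulr_sumr -mulrBr ler_wpM2l// ltW.
- move=> [/= _ [u [phi [ui phic hu ur]]]]; apply: le_trans ur; rewrite subr_ge0.
  have [f [fc phif fphi]] := lipschitz_convex_bigmax i0 phic.
  apply: (@le_trans _ _ (\sum_i p i * f (x i))).
    by apply: ler_sum => i _; rewrite ler_wpM2l.
  apply: (le_trans (p_le fc)); apply: le_Rintegral => //.
    exact: lipschitz_convex_gamma_integrable.
  by move=> y _; have [i ->] := fphi y; have := hu i y; rewrite /= add0r.
- move=> [/= hd _]; have [H Hi hH] := hd; exists (\int[gamma]_y H y).
  split; first exact: dominatedN.
  exists H, (fun _ _ => 0); split => //.
  + by move=> _; exact: lipschitz_convex_cst.
  + by move=> i y /=; rewrite addr0 (le_trans _ (hH i y))// fctE -normrN ler_norm.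
  + by rewrite big1 ?subr0//= => i _; rewrite mulr0.
Qed.

Lemma coupling_cone0 : coupling_cone (0, 0).
Proof.
split.
  exists (fun=> 0); first exact: finite_measure_integrable_cst.
  by move=> i y; rewrite normr0.
exists (fun=> 0), (fun _ _ => 0); split => //=.
- exact: finite_measure_integrable_cst.
- by move=> _; exact: lipschitz_convex_cst.
- by move=> i y; rewrite addr0.
- by rewrite Rintegral_cst// mul0r big1 ?subr0// => i _; rewrite mulr0.
Qed.

Definition below_coupling_cone (L : {scalar (B * B -> R^o)}) : Prop :=
  forall h r, coupling_cone (h, r) -> L h <= r.

Variable L : {scalar (B * B -> R^o)}.
Hypothesis Lle : below_coupling_cone L.

Lemma coupling_le h u : dominated h -> gamma_integrable u ->
  (forall i y, h (x i, y) <= u y) -> L h <= \int[gamma]_y u y.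
Proof.
move=> hd ui hu; apply: Lle; split => //; exists u, (fun _ _ => 0); split => //=.
- by move=> _; exact: lipschitz_convex_cst.
- by move=> i y; rewrite addr0.
- by rewrite big1 ?subr0// => i _; rewrite mulr0.
Qed.

Lemma coupling_ge0 h : dominated h -> (forall i y, 0 <= h (x i, y)) -> 0 <= L h.
Proof.
move=> hd h0; rewrite -oppr_le0 -linearN.
have -> : 0 = \int[gamma]_y (0 : R) by rewrite Rintegral_cst// mul0r.
apply: coupling_le; [exact: dominatedN|exact: finite_measure_integrable_cst|].
by move=> i y; rewrite fctE oppr_le0.
Qed.

Lemma coupling_snd u : gamma_integrable u ->
  L (fun z => u z.2) = \int[gamma]_y u y.
Proof.
move=> ui; have ud : dominated (fun z => u z.2).
  by exists (fun y => `|u y|) => //; exact: integrable_norm.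
apply/eqP; rewrite eq_le coupling_le//= -lerN2 -linearN.
rewrite (le_trans (coupling_le (u := fun y => - u y) _ _ _))//.
- exact: dominatedN.
- by rewrite (_ : _ \o _ = -%E \o (EFin \o u)) //; exact: integrableN.
- under eq_Rintegral do rewrite -mulN1r.
  by rewrite RintegralZl// mulN1r.
Qed.

(** The functions psi for which both psi and -psi are Lipschitz convex are the
    affine ones; for them the barycentre inequality holds both ways. *)
Lemma coupling_affine i h (psi : B -> R^o) : lipschitz_convex psi ->
  lipschitz_convex (fun y => - psi y) ->
  (forall j y, h (x j, y) = if j == i then psi y else 0) ->
  L h = p i * psi (x i).
Proof.
move=> psic npsic hE.
have psii := lipschitz_convex_gamma_integrable psic.
have hd : dominated h.
  exists (fun y => `|psi y|); first exact: integrable_norm.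
  by move=> j y; rewrite hE; case: ifP; rewrite ?normr0.
(* The choice phi_i = - c psi, phi_j = 0 for j != i cancels g, so u = 0 will
   do. *)
have half g (c : R) : dominated g -> (c = 1 \/ c = -1) ->
    (forall j y, g (x j, y) = if j == i then c * psi y else 0) ->
    L g <= c * (p i * psi (x i)).
  move=> gd c1 gE; apply: Lle; split => //.
  exists (fun=> 0), (fun j y => if j == i then - c * psi y else 0); split.
  - exact: finite_measure_integrable_cst.
  - move=> j; case: (j == i); last exact: lipschitz_convex_cst.
    case: c1 => ->; first by under eq_fun do rewrite mulN1r.
    by rewrite (_ : (fun _ => _) = psi)//; apply/funext => y; rewrite opprK mul1r.
  - by move=> j y; rewrite /= gE; case: ifP => _; lra.
  - rewrite Rintegral_cst// mul0r (bigD1 i)//= eqxx big1 => [|j /negbTE ->]; last by rewrite mulr0.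
    by lra.
apply/eqP; rewrite eq_le; apply/andP; split.
  rewrite -[leRHS]mul1r; apply: half => //; first by left.
  by move=> j y; rewrite mul1r.
rewrite -lerN2 -linearN -[leRHS]mulN1r; apply: half; first exact: dominatedN.
  by right.
by move=> j y; rewrite fctE hE; case: ifP => _; rewrite ?oppr0// mulN1r.
Qed.

End CouplingCone.

(** * From the functional to a probability measure *)
Section ContentContinuity.
Context d (T : measurableType d) (R : realType) (nu : set T -> R).
Hypothesis nu_ge0 : forall A, 0 <= nu A.
Hypothesis nuU : forall A C, measurable A -> measurable C -> A `&` C = set0 ->
  nu (A `|` C) = nu A + nu C.
Hypothesis nu_cvg0 : forall F : nat -> set T, (forall n, measurable (F n)) ->
  nonincreasing_seq F -> \bigcap_n F n = set0 -> nu (F n) @[n --> \oo] --> 0.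

(** The remainder of the n-th partial union decreases to the empty set. *)
Lemma content_sigma_additive : semi_sigma_additive (fun A => (nu A)%:E).
Proof.
have nu0 : nu set0 = 0.
  have := nuU measurable0 measurable0 (setI0 set0).
  by rewrite setU0 => /eqP; rewrite -subr_eq subrr => /eqP.
move=> F mF tF mUF; pose U := \bigcup_n F n.
pose S n := \big[setU/set0]_(i < n) F i.
have mS n : measurable (S n) by exact: bigsetU_measurable.
have SU n : S n `<=` U.
  by rewrite /S -bigcup_mkord => z [i _ Fiz]; exists i.
have nuS n : nu (S n) = \sum_(0 <= i < n) nu (F i).
  elim: n => [|n IH]; first by rewrite /S big_ord0 big_geq.
  rewrite big_nat_recr// -IH /S big_ord_recr (nuU (mS n) (mF n))//.
  rewrite /S -bigcup_mkord; apply/seteqP; split => // z [[i /= i_lt Fi] Fn].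
  have : i = n by apply: tF => //; exists z.
  by move=> in_; rewrite in_ ltnn in i_lt.
have nuD n : nu (S n) = nu U - nu (U `\` S n).
  rewrite -[in X in nu X - _](setDUK (SU n)) nuU ?addrK//; first exact: measurableD.
  by rewrite setDE setICA setICr setI0.
have cvg0 : nu (U `\` S n) @[n --> \oo] --> 0.
  apply: nu_cvg0 => [n||]; first exact: measurableD.
    move=> m n mn; apply/subsetPset; apply: setDS.
    by rewrite /S -!bigcup_mkord => z [i /= im Fi]; exists i => //=; exact: leq_trans mn.
  apply/seteqP; split => // z zU; have [[k _ Fk] _] := zU 0%N I.
  have [_] := zU k.+1 I; apply; rewrite /S -bigcup_mkord.
  by exists k => /=.
under eq_fun do rewrite sumEFin -nuS nuD.
apply: cvg_EFin; first exact: nearW.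
rewrite -[X in _ --> X]subr0; apply: cvgB => //; exact: cvg_cst.
Qed.

Lemma content_probability : nu setT = 1 ->
  exists P : probability T R, forall A, P A = (nu A)%:E.
Proof.
move=> nu1; pose m A := (nu A)%:E.
have m0 : m set0 = 0%E.
  have := nuU measurable0 measurable0 (setI0 set0).
  by rewrite setU0 => /eqP; rewrite -subr_eq subrr /m => /eqP <-.
have mge0 A : (0 <= m A)%E by rewrite lee_fin.
have m1 : m setT = 1%E by rewrite /m nu1.
pose M := isMeasure.Build d T R m m0 mge0 content_sigma_additive.
pose mu : {measure set T -> \bar R} := HB.pack m M.
pose P : probability T R := HB.pack m M (Measure_isProbability.Build _ _ _ mu m1).
by exists P.
Qed.

End ContentContinuity.

Section CouplingMeasure.
Context {R : realType} {B : completeNormedModType R}.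
Variables (gamma : probability (borel B) R) (I : finType) (x : I -> B) (p : I -> R).
Hypothesis gamma1 : finite_first_moment gamma.
Variable L : {scalar (B * B -> R^o)}.
Hypothesis Lle : below_coupling_cone gamma x p L.
Implicit Types (h : B * B -> R^o) (u : B -> R).

Local Notation gamma_integrable u := (gamma.-integrable setT (EFin \o u)).

Lemma dominated_indic (A : set (B * B)) : dominated gamma x (\1_A : B * B -> R^o).
Proof.
exists (fun=> 1); first exact: finite_measure_integrable_cst.
by move=> i y; rewrite indicE; case: (_ \in _); rewrite ?normr1 ?normr0.
Qed.

Lemma measurable_section i (A : set (borel (B * B))) : measurable A ->
  measurable ([set y | A (x i, y)] : set (borel B)).
Proof.
have m : measurable_fun setT ((fun y => (x i, y)) : borel B -> borel (B * B)).
  apply: (@continuous_borel_measurable R B (B * B)%type) => y.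
  by apply: cvg_pair; [exact: cvg_cst|exact: cvg_id].
by move=> mA; have := m measurableT _ mA; rewrite setTI.
Qed.

(** This domination by a finite sum of measures is what makes A |-> L(1_A)
    continuous at the empty set. *)
Lemma coupling_indic_le (A : set (borel (B * B))) : measurable A ->
  L (\1_A : B * B -> R^o) <= \sum_i fine (gamma [set y | A (x i, y)]).
Proof.
move=> mA; pose u i : B -> R := \1_[set y : borel B | A (x i, y)].
have ui i : gamma_integrable (u i).
  by apply: integrable_indic; exact: measurable_section.
have -> : \sum_i fine (gamma [set y | A (x i, y)]) = \int[gamma]_y (\sum_i u i y).
  rewrite /Rintegral; under eq_integral do rewrite -sumEFin.
  rewrite integral_sum// -sum_fine => [|i _]; last exact: integrable_fin_num (ui i).
  apply: eq_bigr => i _; rewrite integral_indic ?setIT//.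
  exact: measurable_section.
apply: (coupling_le Lle); first exact: dominated_indic.
  rewrite (_ : _ \o _ = (fun y => \sum_i (u i y)%:E)%E); last first.
    by apply/funext => y /=; rewrite sumEFin.
  apply: integrable_sum => // i _; exact: ui.
move=> i y; rewrite (bigD1 i)//= [leLHS](_ : _ = u i y); last first.
  by rewrite /u !indicE; congr (_%:R); apply/idP/idP => /set_mem ?; exact: mem_set.
by rewrite lerDl sumr_ge0// => j _; rewrite /u indicE.
Qed.

Lemma coupling_measure_exists : exists pi : probability (borel (B * B)) R,
  forall A, pi A = (L (\1_A : B * B -> R^o))%:E.
Proof.
apply: (@content_probability _ (borel (B * B)) R (fun A => L (\1_A : B * B -> R^o))).
- move=> A; apply: (coupling_ge0 Lle); first exact: dominated_indic.
  by move=> i y; rewrite indicE.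
- move=> A C mA mC AC0; rewrite -linearD; congr (L _); apply/funext => z.
  rewrite fctE !indicE in_setU; have [zA|] := boolP (z \in A); last by rewrite add0r.
  rewrite (_ : z \in C = false) ?addr0//; apply/negP => zC.
  have : (A `&` C) z by split; exact: set_mem.
  by rewrite AC0.
- move=> F mF ndF F0.
  have sF : \sum_i fine (gamma [set y | F n (x i, y)]) @[n --> \oo] --> (0 : R).
    rewrite [X in _ --> X](_ : 0 = \sum_(i : I) 0); last by rewrite big1.
    apply: cvg_big => [|i _]; first exact: add_continuous.
    apply: fine_cvg.
    pose G n : set (borel B) := [set y | F n (x i, y)].
    have -> : 0%:E = gamma (\bigcap_n G n).
      rewrite (_ : \bigcap_n G n = set0) ?measure0//; apply/seteqP; split => // y Gy.
      by have : (\bigcap_n F n) (x i, y) by []; rewrite F0.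
    apply: nonincreasing_cvg_mu.
    + by rewrite ltey_eq fin_num_measure//; exact: measurable_section.
    + by move=> n; exact: measurable_section.
    + by apply: bigcap_measurable => // n _; exact: measurable_section.
    + move=> m n mn; apply/subsetPset => y; rewrite /G /=.
      by have /subsetPset := ndF _ _ mn; exact.
  apply: (squeeze_cvgr _ (cvg_cst 0) sF); apply: nearW => n.
  rewrite coupling_indic_le// andbT; apply: (coupling_ge0 Lle).
    exact: dominated_indic.
  by move=> i y; rewrite indicE.
- have := coupling_snd Lle (finite_measure_integrable_cst gamma 1 measurableT).
  rewrite Rintegral_cst// mul1r.
  rewrite [X in _ = fine X](probability_setT gamma) /= => <-; congr (L _).
  by apply/funext => z; rewrite indicT.
Qed.

Variable pi : probability (borel (B * B)) R.
Hypothesis piE : forall A, pi A = (L (\1_A : B * B -> R^o))%:E.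

Lemma coupling_second_marginal : second_marginal pi gamma.
Proof.
move=> A mA; rewrite /pushforward piE.
have := coupling_snd Lle (u := \1_A) (integrable_indic gamma mA).
rewrite (_ : (fun _ => _) = \1_(snd @^-1` A)); last first.
  by apply/funext => z; rewrite !indicE.
by move=> ->; rewrite /Rintegral integral_indic// setIT fineK// fin_num_measure.
Qed.

Import HBNNSimple.

(** On simple functions L and the integral agree by linearity, and L is
    monotone. *)
Lemma coupling_ge0_integral_le h :
  measurable_fun setT (h : borel (B * B) -> R) ->
  dominated gamma x h -> (forall z, 0 <= h z) ->
  (\int[pi]_z (h z)%:E <= (L h)%:E)%E.
Proof.
move=> mh hd h0; rewrite ge0_integralTE//=.
apply: ge_ereal_sup => _ [g /= gh <-].
have gL : (sintegral pi g = (L (g : B * B -> R^o))%:E)%E.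
  rewrite sintegralE fsbig_finite//=.
  under eq_bigr do rewrite piE -EFinM.
  rewrite sumEFin; congr EFin.
  under eq_bigr do rewrite -[_ * L _]linearZ.
  rewrite -linear_sum; congr (L _); apply/funext => z.
  by rewrite [RHS](fimfunE g) fsbig_finite//= fct_sumE.
rewrite gL lee_fin -subr_ge0 -linearB.
have [H Hi hH] := hd.
have gd : dominated gamma x (g : B * B -> R^o).
  exists H => // i y; rewrite (le_trans _ (hH i y))// !ger0_norm//.
  by have := gh (x i, y); rewrite lee_fin.
apply: (coupling_ge0 Lle).
  by apply: dominatedD => //; exact: dominatedN.
by move=> i y; rewrite fctE subr_ge0; have := gh (x i, y); rewrite lee_fin.
Qed.

(** Both u + h and u - h are nonnegative, and for u itself L is the integral
    because the second marginal is gamma; so the one-sided bound for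
    nonnegative functions gives both inequalities. *)
Lemma coupling_integral h u :
  measurable_fun setT (h : borel (B * B) -> R) -> gamma_integrable u ->
  (forall z, `|h z| <= u z.2) ->
  \int[pi]_z h z = L h.
Proof.
move=> mh ui hu.
have [upi uE] := integral_marginal measurable_snd_borel coupling_second_marginal ui.
have u0 y : 0 <= u y by apply: le_trans (hu (0, y)).
have hi : pi.-integrable setT (EFin \o h).
  apply: le_integrable upi => //; first exact/measurable_EFinP.
  by move=> z _; rewrite /= lee_fin (ger0_norm (u0 _)).
have mu2 : measurable_fun setT (fun z : borel (B * B) => u z.2).
  by apply/measurable_EFinP; exact: measurable_int upi.
have ud : dominated gamma x (fun z => u z.2).
  by exists u => // i y; rewrite ger0_norm.
have half g : pi.-integrable setT (EFin \o g) -> (forall z, `|g z| <= u z.2) ->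
    \int[pi]_z g z <= L g.
  move=> gi gu; have mg : measurable_fun setT (g : borel (B * B) -> R).
    by apply/measurable_EFinP; exact: measurable_int gi.
  have gd : dominated gamma x g by exists u => // i y; exact: gu.
  pose k : B * B -> R^o := (fun z => u z.2) + g.
  have k0 z : 0 <= k z by have := gu z; rewrite ler_norml /k fctE; lra.
  have ki : pi.-integrable setT (EFin \o k).
    rewrite (_ : _ \o _ = (EFin \o (u \o snd)) \+ (EFin \o g)) //.
    exact: integrableD.
  have : \int[pi]_z k z <= L k.
    rewrite -lee_fin fineK; last exact: integrable_fin_num ki.
    apply: coupling_ge0_integral_le => //; last exact: dominatedD.
    exact: measurable_funD.
  rewrite RintegralD// linearD/= (coupling_snd Lle ui) uE.
  by rewrite lerD2l.
apply/eqP; rewrite eq_le half//= -lerN2 -linearN.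
have <- : \int[pi]_z (- h) z = - \int[pi]_z h z.
  under eq_Rintegral do rewrite fctE -mulN1r.
  by rewrite RintegralZl// mulN1r.
apply: half; last by move=> z; rewrite fctE normrN.
by rewrite (_ : _ \o _ = -%E \o (EFin \o h)) //; exact: integrableN.
Qed.

(** On the support of the coupling the max norm of (x_i, y) is at most the norm
    of y plus the sum of the norms of the x_j. *)
Lemma coupling_first_moment : finite_first_moment pi.
Proof.
rewrite /finite_first_moment.
apply: le_lt_trans (coupling_ge0_integral_le _ _ _) (ltry _) => //.
  by apply: measurable_norm; exact: measurable_id.
exists (fun y => `|y| + \sum_j `|x j|).
  rewrite (_ : _ \o _ = (EFin \o (fun y : borel B => `|y : B|)) \+ (EFin \o cst (\sum_j `|x j|))) //.
  apply: integrableD => //; last exact: finite_measure_integrable_cst.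
  exact: (lipschitz_convex_gamma_integrable gamma1 lipschitz_convex_norm).
move=> i y; rewrite normr_id prod_normE ge_max/= (bigD1 i)//=.
rewrite lerDl addrCA lerDl !addr_ge0// ?sumr_ge0//.
Qed.

End CouplingMeasure.

(** * Strassen's theorem for a finitely supported measure *)
Section FiniteSupport.
Context {R : realType} {B : normedModType R}.

Lemma measurable_set1_borel (v : B) : measurable ([set v] : set (borel B)).
Proof.
rewrite -(setCK [set v]); apply: measurableC; apply: sub_sigma_algebra.
apply: closed_openC; apply: accessible_closed_set1.
exact: hausdorff_accessible (@norm_hausdorff _ B).
Qed.

Lemma finitely_supportedP (zeta : probability (borel B) R) :
  finitely_supported zeta -> exists (I : finType) (i0 : I) (x : I -> B),
    injective x /\ forall A, measurable A ->
      zeta A = (\sum_i (fine (zeta [set x i]))%:E * \d_(x i : borel B) A)%E.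
Proof.
move=> [S finS zetaS].
pose x (i : fset_set S) : B := val i.
have Sx : S = \bigcup_(i in [set: fset_set S]) [set x i].
  apply/seteqP; split=> [v Sv|v [i _ /= ->]].
    have vS : v \in fset_set S by rewrite in_fset_set//; exact: mem_set.
    by exists [` vS]%fset.
  by have := valP i; rewrite in_fset_set// => /set_mem.
have S0 : S !=set0.
  apply/set0P/eqP => SE; move: zetaS; rewrite SE measure0 => -[/esym/eqP].
  by rewrite oner_eq0.
have [v0 Sv0] := S0.
have v0S : v0 \in fset_set S by rewrite in_fset_set//; exact: mem_set.
exists (fset_set S), [` v0S]%fset, x; split; first exact: val_inj.
have mS : measurable (S : set (borel B)).
  rewrite Sx; apply: fin_bigcup_measurable; first exact: finite_finset.
  by move=> i _; exact: measurable_set1_borel.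
move=> A mA.
have -> : zeta A = zeta (A `&` S).
  have mSC : measurable (~` S : set (borel B)) by exact: measurableC.
  have zS : zeta (~` S) = 0%E by rewrite probability_setC// zetaS subee.
  rewrite -[in LHS](setIT A) -(setUv S) setIUr measureU//; last 3 first.
  - exact: measurableI.
  - exact: measurableI.
  - by rewrite setIACA setICr setI0.
  rewrite [X in (_ + X)%E](_ : _ = 0%E) ?adde0//.
  by apply: (subset_measure0 _ _ _ zS); [exact: measurableI|exact: mSC|exact: subIsetr].
rewrite [in LHS]Sx setI_bigcupr measure_fin_bigcup//; last 3 first.
- exact: finite_finset.
- by move=> i j _ _ [v [[_ /= ->] [_ /= /val_inj]]].
- by move=> i _; apply: measurableI => //; exact: measurable_set1_borel.
have -> : [set: fset_set S] = [set` index_enum (fset_set S)].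
  by apply/seteqP; split=> // i _; rewrite /= mem_index_enum.
rewrite -fsbig_seq ?index_enum_uniq//; apply: eq_bigr => i _.
rewrite fineK ?fin_num_measure//; last exact: measurable_set1_borel.
rewrite diracE; have [xA|xA] := boolP (x i \in A).
  by rewrite mule1; congr (zeta _); apply/setIidr => v /= ->; exact: set_mem.
rewrite mule0 (_ : _ `&` _ = set0) ?measure0//.
by apply/seteqP; split=> // v [/= + vx]; rewrite vx => /mem_set; exact/negP.
Qed.

End FiniteSupport.

Section Strassen.
Context {R : realType} {B : completeNormedModType R}.

(** The functional given by the Hahn-Banach theorem defines the coupling.  On
    the cell of x_i it integrates affine functions like the mass p_i at x_i:
    the constant 1 yields the mass, bounded functionals yield the
    barycentre. *)
Theorem convex_le_barycentric_quantisation (zeta gamma : probability (borel B) R) :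
  separable B -> finite_first_moment zeta -> finite_first_moment gamma ->
  convex_le zeta gamma -> finitely_supported zeta ->
  exists pi : probability (borel (B * B)) R, finite_first_moment pi /\
    exists (I : finType) (P1 : I -> set (borel B)),
      barycentric_quantisation zeta gamma pi P1 (fun _ : unit => [set: borel B]).
Proof.
move=> sepB zeta1 gamma1 /(convex_leP zeta1 gamma1) zeta_gamma zetafin.
have [I [i0 [x [x_inj zetaE]]]] := finitely_supportedP zetafin.
pose p i := fine (zeta [set x i]).
have p_ge0 i : 0 <= p i by exact: fine_ge0.
have p_le (f : B -> R^o) : lipschitz_convex f ->
    \sum_i p i * f (x i) <= \int[gamma]_y f y.
  move=> fc; have [lf _] := fc.
  have := @integral_dirac_sum _ (borel B) R I xpredT p x p_ge0 zeta f zetaE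
    (lipschitz_borel_measurable lf).
  by move=> <-; exact: zeta_gamma.
have [L Lle] := hahn_banach_cone (coupling_cone_constraint gamma1 p_ge0 p_le i0)
  (coupling_cone0 gamma x p).
have [pi piE] := coupling_measure_exists Lle.
have marg := coupling_second_marginal Lle piE.
have pi1 := coupling_first_moment gamma1 Lle piE.
(* The complement of the support joins the cell of one support point, since a
   cell of its own would be empty when B is a single point. *)
pose P1 i : set (borel B) := [set x i] `|` (if i == i0 then ~` range x else set0).
have P1x i j : P1 i (x j) <-> j = i.
  split=> [|->]; last by left.
  case=> [/x_inj//|]; case: ifP => // _ nx; exfalso; apply: nx.
  by exists j.
have mP1 i : measurable (P1 i).
  apply: measurableU; first exact: measurable_set1_borel.
  case: ifP => // _; apply: measurableC.
  have -> : range x = \bigcup_(j in [set: I]) [set x j].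
    by apply/seteqP; split=> [_ [j _ <-]|v [j _ /= ->]]; exists j.
  apply: fin_bigcup_measurable; first exact: finite_finset.
  by move=> j _; exact: measurable_set1_borel.
pose C i : set (borel (B * B)) := P1 i `*` setT.
have mC i : measurable (C i) by exact: measurable_rectangle_borel.
have intC i (psi : B -> R^o) : lipschitz_convex psi ->
    lipschitz_convex (fun y => - psi y) ->
    \int[pi]_(z in C i) psi z.2 = p i * psi (x i).
  move=> psic npsic; have [lpsi _] := psic.
  pose h : B * B -> R^o := (fun z : B * B => psi z.2) \_ (C i).
  have psii := lipschitz_convex_gamma_integrable gamma1 psic.
  rewrite Rintegral_mkcond (coupling_integral Lle piE (h := h) (u := fun y => `|psi y|)).
  - apply: (coupling_affine gamma1 Lle psic npsic) => j y; rewrite /h patchE.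
    have [->|ji] := eqVneq j i; first by rewrite mem_set//; split => //; exact/P1x.
    by rewrite memNset// => -[/P1x/eqP]; rewrite (negbTE ji).
  - apply/(measurable_restrictT _ (mC i)); apply: measurable_funTS.
    exact: (measurableT_comp (lipschitz_borel_measurable lpsi) measurable_snd_borel).
  - exact: integrable_norm.
  - by move=> z; rewrite /h patchE; case: ifP; rewrite ?normr0.
have massC i : pi (C i) = (p i)%:E.
  have := intC i (fun=> 1) (lipschitz_convex_cst _) (lipschitz_convex_cst _).
  by rewrite Rintegral_cst// mul1r mulr1 => <-; rewrite fineK// fin_num_measure.
have baryC i : bochner_integral pi (C i) (snd : borel (B * B) -> B) = p i *: x i.
  set b := bochner_integral _ _ _.
  have bE : is_bochner_integral pi (C i) (snd : borel (B * B) -> B) b.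
    exact: bochner_integral_snd_exists.
  have [l l1 lb] := norming_functional (b - p i *: x i).
  have lk w : `|l w| <= 1 * `|w| by rewrite mul1r.
  apply/eqP; rewrite -subr_eq0 -normr_eq0 -lb linearB linearZ/=.
  have [_ ->] := bochner_functional (mC i) bE lk.
  rewrite (intC i (l : B -> R^o)) ?subrr//.
    have -> : (l : B -> R^o) = (fun y => 1 * l y) by apply/funext => y; rewrite mul1r.
    exact: lipschitz_convex_scale_linear lk.
  have -> : (fun y => - l y) = (fun y => -1 * l y) by apply/funext => y; rewrite mulN1r.
  exact: lipschitz_convex_scale_linear lk.
exists pi; split => //; exists I, P1; split => //.
- split; last exact: mP1.
  split.
  + apply/seteqP; split => // y _; have [[j _ <-]|yx] := pselect (range x y).
      by exists j => //; left.
    by exists i0 => //; right; rewrite eqxx.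
  + move=> i j _ _ [y [+ +]].
    case=> [/= ->|+ Pj]; first by move/P1x.
    case: ifP => // /eqP -> yx; case: Pj => [/= yE|].
      by exfalso; apply: yx; exists j.
    by case: ifP => // /eqP ->.
  + by move=> i _; exists (x i); left.
- split; last by move=> _; exact: measurableT.
  split; last by move=> _ _; exists 0.
    by apply/seteqP; split => // y _; exists tt.
  by move=> [] [].
- move=> A mA; rewrite zetaE//; apply: eq_bigr => i _.
  rewrite big_mkcond (bigD1 tt)//= [X in _ + X]big1 ?adde0; last by case.
  rewrite /cell_barycentre /cell_mass -/(C i) massC baryC lte_fin -/(p i).
  case: ifPn => [pi_gt0|].
    by rewrite scalerA mulVf ?scale1r// gt_eqF.
  rewrite -leNgt => pi_le0; have -> : p i = 0 by apply/eqP; rewrite eq_le pi_le0 p_ge0.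
  by rewrite mul0e.
Qed.

End Strassen.

(** The third condition is a case of the second, and each of them implies the
    first by Jensen's inequality; the first implies the third by Strassen's
    theorem. *)
Theorem theorem36 (R : realType) (B : completeNormedModType R)
    (sepB : separable B) (zeta gamma : probability (borel B) R)
    (zeta1 : finite_first_moment zeta) (gamma1 : finite_first_moment gamma) :
  [<-> convex_le zeta gamma /\ finitely_supported zeta;
       exists pi : probability (borel (B * B)) R,
         finite_first_moment pi /\
         exists (I J : finType) (P1 : I -> set (borel B)) (P2 : J -> set (borel B)),
           barycentric_quantisation zeta gamma pi P1 P2;
       exists pi : probability (borel (B * B)) R,
         finite_first_moment pi /\
         exists (I : finType) (P1 : I -> set (borel B)),
           barycentric_quantisation zeta gamma pi P1 (fun _ : unit => [set: borel B])].
Proof.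
have strassen : convex_le zeta gamma /\ finitely_supported zeta ->
    exists pi : probability (borel (B * B)) R, finite_first_moment pi /\
      exists (I : finType) (P1 : I -> set (borel B)),
        barycentric_quantisation zeta gamma pi P1 (fun _ : unit => [set: borel B]).
  by move=> [zg zfin]; exact: convex_le_barycentric_quantisation.
have jensen (pi : probability (borel (B * B)) R) (I J : finType)
    (P1 : I -> set (borel B)) (P2 : J -> set (borel B)) :
    finite_first_moment pi -> barycentric_quantisation zeta gamma pi P1 P2 ->
    convex_le zeta gamma /\ finitely_supported zeta.
  move=> pi1 bq; split; last by case: bq.
  exact: barycentric_quantisation_convex_le bq.
tfae.
- move=> /strassen[pi [pi1 [I [P1 bq]]]].
  by exists pi; split => //; exists I, unit, P1, (fun _ : unit => [set: borel B]).
- by move=> [pi [pi1 [I [J [P1 [P2 bq]]]]]]; apply: strassen; exact: jensen bq.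
- by move=> [pi [pi1 [I [P1 bq]]]]; exact: jensen bq.
Qed.
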